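(* Let $X$ be a topological space, let $\tilde f,\tilde g: I\times X\to\mathbb{R}$ be two (not necessarily continuous) functions, let $k$ be a field and let $j\ge 0$. Let $H_jF$ and $H_jG$ be the multiparameter persistence modules (with coefficients in $k$) associated to $\tilde f$ and $\tilde g$, respectively. Then $$d_I(H_jF,H_jG)\le d_\infty(\tilde f,\tilde g),\qquad\text{where } d_\infty(\tilde f,\tilde g)=\sup_{(t,x)\in I\times X}|\tilde f(t,x)-\tilde g(t,x)|.$$
   Context: $I=[0,1]$. Let $\Delta^2=\{(a,b)\mid 0\le a\le b\le 1\}$, partially ordered by $(a,b)\le(a',b')$ iff $a'\le a\le b\le b'$ (i.e. $[a,b]\subset[a',b']$). The poset $\Delta^2\times\mathbb{R}$ has the product order, with the usual order on $\mathbb{R}$, and is regarded as a category. Given a function $\tilde f:I\times X\to\mathbb{R}$ (a one-parameter family of functions $\tilde f_t(x)=\tilde f(t,x)$), let $f:I\times X\to I\times\mathbb{R}$, $f(t,x)=(t,\tilde f(t,x))$. The associated diagram of spaces is the functor $F$ from $\Delta^2\times\mathbb{R}$ to topological spaces given by $F(a,b,c)=f^{-1}([a,b]\times(-\infty,c])\subset I\times X$ (subspace topology), with morphisms the inclusions. The associated multiparameter persistence module $H_jF$ is its composition with singular homology $H_j(-;k)$, a functor from $\Delta^2\times\mathbb{R}$ to $k$-vector spaces. $G$ and $H_jG$ are defined in the same way from $\tilde g$. For $\varepsilon\ge 0$ let $\Omega_\varepsilon(a,b,c)=(a,b,c+\varepsilon)$ on $\Delta^2\times\mathbb{R}$. Two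 functors $M,N$ on $\Delta^2\times\mathbb{R}$ with the same target category are $\Omega_\varepsilon$-interleaved if there are natural transformations $\varphi:M\to N\circ\Omega_\varepsilon$ and $\psi:N\to M\circ\Omega_\varepsilon$ such that, for every $p\in\Delta^2\times\mathbb{R}$, $\psi_{\Omega_\varepsilon(p)}\circ\varphi_p=M(p\le\Omega_{2\varepsilon}(p))$ and $\varphi_{\Omega_\varepsilon(p)}\circ\psi_p=N(p\le\Omega_{2\varepsilon}(p))$. The interleaving distance $d_I(M,N)$ is the infimum of all $\varepsilon\ge0$ for which $M$ and $N$ are $\Omega_\varepsilon$-interleaved (equal to $\infty$ if there are none). *)

(* Defs.v *)
From HB Require Import structures.
From mathcomp Require Import all_boot all_order all_algebra.
From mathcomp Require Import freeg zify.
From mathcomp Require Import all_classical all_reals topology normedtype ereal.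

Set Implicit Arguments.
Unset Strict Implicit.
Unset Printing Implicit Defensive.

Import Order.TTheory GRing.Theory Num.Theory.
Import numFieldNormedType.Exports.

Local Open Scope classical_set_scope.
Local Open Scope ring_scope.

Record category := Category {
  obj :> Type;
  mor : obj -> obj -> Type;
  cat_id : forall a, mor a a;
  cat_comp : forall a b c, mor b c -> mor a b -> mor a c;
  cat_compA : forall a b c d (h : mor c d) (g : mor b c) (f : mor a b),
    cat_comp h (cat_comp g f) = cat_comp (cat_comp h g) f;
  cat_comp1f : forall a b (f : mor a b), cat_comp (cat_id b) f = f;
  cat_compf1 : forall a b (f : mor a b), cat_comp f (cat_id a) = f
}.
Arguments mor {_} _ _.
Arguments cat_id {_} _.
Arguments cat_comp {_ _ _ _} _ _.

Record functor (C D : category) := Functor {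
  functor_obj :> C -> D;
  functor_map : forall a b : C, mor a b -> mor (functor_obj a) (functor_obj b);
  functor_map_id : forall a, functor_map (cat_id a) = cat_id (functor_obj a);
  functor_map_comp : forall a b c (g : mor b c) (f : mor a b),
    functor_map (cat_comp g f) = cat_comp (functor_map g) (functor_map f)
}.
Arguments functor_map {_ _} _ {_ _} _.

Section FunctorComp.
Context (C D E : category) (G : functor D E) (F : functor C D).

Let gf_map (a b : C) (u : mor a b) : mor (G (F a)) (G (F b)) :=
  functor_map G (functor_map F u).

Fact functor_comp_id a : gf_map (cat_id a) = cat_id (G (F a)).
Proof. by rewrite /gf_map !functor_map_id. Qed.

Fact functor_comp_comp a b c (v : mor b c) (u : mor a b) :
  gf_map (cat_comp v u) = cat_comp (gf_map v) (gf_map u).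
Proof. by rewrite /gf_map !functor_map_comp. Qed.

Definition functor_comp : functor C E :=
  Functor functor_comp_id functor_comp_comp.

End FunctorComp.

Record nat_trans (C D : category) (F G : functor C D) := NatTrans {
  component :> forall a : C, mor (F a) (G a);
  naturality : forall (a b : C) (u : mor a b),
    cat_comp (component b) (functor_map F u) =
    cat_comp (functor_map G u) (component a)
}.

Section PosetCategory.
Context (d : Order.disp_t) (P : porderType d).

Let le_hom (x y : P) : Type := (x <= y)%O.

Definition poset_category : category.
Proof.
refine (@Category P le_hom (fun x => lexx x)
  (fun x y z (yz : le_hom y z) (xy : le_hom x y) => le_trans xy yz) _ _ _);
  move=> *; exact: bool_irrelevance.
Defined.

End PosetCategory.

Section TopCat.

Let top_id (X : topologicalType) : continuousType X X := @idfun X.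
Let top_comp (X Y Z : topologicalType) (g : continuousType Y Z)
  (f : continuousType X Y) : continuousType X Z := g \o f.

Definition TopCat : category.
Proof.
refine (@Category topologicalType (fun X Y => continuousType X Y)
  top_id top_comp _ _ _); move=> *; exact/continuousEP.
Defined.

End TopCat.

Section VectCat.
Context (k : fieldType).

Lemma linear_eqP (U V : lmodType k) (f g : {linear U -> V}) : f =1 g -> f = g.
Proof.
case: f g => [f cf] [g cg] /= /funext fg; move: cf cg; rewrite fg => cf cg.
congr (GRing.Linear.Pack _).
case: cf cg => [[a] [b]] [[a'] [b']].
by rewrite (Prop_irrelevance a a') (Prop_irrelevance b b').
Qed.

Let vect_id (U : lmodType k) : {linear U -> U} := idfun.
Let vect_comp (U V W : lmodType k) (g : {linear V -> W}) (f : {linear U -> V}) :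
  {linear U -> W} := g \o f.

Definition VectCat : category.
Proof.
refine (@Category (lmodType k) (fun U V => {linear U -> V})
  vect_id vect_comp _ _ _); move=> *; exact/linear_eqP.
Defined.

End VectCat.

Section Homology.
Context (k : fieldType) (U V W : lmodType k).
Context (f : {linear U -> V}) (g : {linear V -> W}).

Definition ker_pred : {pred V} := fun v => g v == 0.

Fact ker_submod_closed : submod_closed ker_pred.
Proof.
split=> [|a x y]; rewrite !unfold_in ?linear0 // => /eqP gx /eqP gy.
by rewrite linearP gx gy scaler0 addr0.
Qed.

HB.instance Definition _ :=
  GRing.isSubmodClosed.Build k V ker_pred ker_submod_closed.

Record cycles := Cycle { cycle_val : V; _ : cycle_val \in ker_pred }.

HB.instance Definition _ := [isSub for cycle_val].
HB.instance Definition _ := [Choice of cycles by <:].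
HB.instance Definition _ := [SubChoice_isSubLmodule of cycles by <:].

(* ker g / (im f inside ker g), so that no hypothesis g \o f = 0 is needed; the
   singular boundary satisfies it, see dsing_dsing. *)
Definition boundaries : {pred cycles} := fun z => `[< exists u, f u = val z >].

Lemma boundariesP z : reflect (exists u, f u = val z) (z \in boundaries).
Proof. exact: asboolP. Qed.

Fact boundaries_submod_closed : submod_closed boundaries.
Proof.
split=> [|a x y /boundariesP[u fu] /boundariesP[v fv]]; apply/boundariesP.
  by exists 0; rewrite !linear0.
by exists (a *: u + v); rewrite !linearP fu fv.
Qed.

HB.instance Definition _ :=
  GRing.isSubmodClosed.Build k cycles boundaries boundaries_submod_closed.

Definition homology := Quotient.quot boundaries.

HB.instance Definition _ := GRing.Zmodule.on homology.

Definition homology_class (z : cycles) : homology :=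
  (\pi_(Quotient.quot boundaries) z)%qT.

Lemma homology_classP z z' :
  homology_class z = homology_class z' <-> z - z' \in boundaries.
Proof. by rewrite Quotient.idealrBE; split=> /eqP. Qed.

Lemma homology_class_surj (h : homology) : {z | homology_class z = h}.
Proof. by exists (repr h); exact: reprK. Qed.

Fact homology_class_is_zmod_morphism : zmod_morphism homology_class.
Proof. by move=> x y; rewrite /homology_class raddfB. Qed.

HB.instance Definition _ := GRing.isZmodMorphism.Build cycles homology
  homology_class homology_class_is_zmod_morphism.

Definition homology_scale (a : k) (h : homology) : homology :=
  homology_class (a *: repr h).

Lemma homology_scale_class a z :
  homology_scale a (homology_class z) = homology_class (a *: z).
Proof.
apply/homology_classP; rewrite -scalerBr.
apply: rpredZ.
by apply/homology_classP; rewrite [LHS]reprK.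
Qed.

Fact homology_scaleA a b h :
  homology_scale a (homology_scale b h) = homology_scale (a * b) h.
Proof.
by have [z <-] := homology_class_surj h; rewrite !homology_scale_class scalerA.
Qed.

Fact homology_scale1 : left_id 1 homology_scale.
Proof.
move=> h; have [z <-] := homology_class_surj h.
by rewrite homology_scale_class scale1r.
Qed.

Fact homology_scaleDr : right_distributive homology_scale +%R.
Proof.
move=> a h h'; have [z <-] := homology_class_surj h.
have [z' <-] := homology_class_surj h'.
by rewrite -raddfD !homology_scale_class scalerDr raddfD.
Qed.

Fact homology_scaleDl h : {morph homology_scale^~ h : a b / a + b}.
Proof.
move=> a b; have [z <-] := homology_class_surj h.
by rewrite !homology_scale_class scalerDl raddfD.
Qed.

HB.instance Definition _ := GRing.Zmodule_isLmodule.Build k homology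
  homology_scaleA homology_scale1 homology_scaleDr homology_scaleDl.

Fact homology_class_is_scalable : scalable homology_class.
Proof. by move=> a z; rewrite -homology_scale_class. Qed.

HB.instance Definition _ := GRing.isScalable.Build k cycles homology *:%R
  homology_class homology_class_is_scalable.

End Homology.

Section HomologyMap.
Context (k : fieldType) (U V W U' V' W' : lmodType k).
Context (f : {linear U -> V}) (g : {linear V -> W}).
Context (f' : {linear U' -> V'}) (g' : {linear V' -> W'}).
Context (a : {linear U -> U'}) (b : {linear V -> V'}) (c : {linear W -> W'}).
Hypothesis (baf : b \o f =1 f' \o a) (cbg : c \o g =1 g' \o b).

Fact cycle_map_subproof (z : cycles g) : b (val z) \in ker_pred g'.
Proof.
case: z => z /= /eqP gz; rewrite unfold_in.
by have /= <- := cbg z; rewrite gz linear0.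
Qed.

Definition cycles_map (z : cycles g) : cycles g' :=
  Cycle (cycle_map_subproof z).

Fact cycle_map_is_linear : linear cycles_map.
Proof. by move=> l x y; apply/val_inj; rewrite /= linearP. Qed.

HB.instance Definition _ := GRing.isLinear.Build k (cycles g) (cycles g') *:%R
  cycles_map cycle_map_is_linear.

Definition homology_fun (h : homology f g) : homology f' g' :=
  homology_class f' (cycles_map (repr h)).

Lemma homology_fun_class z :
  homology_fun (homology_class f z) = homology_class f' (cycles_map z).
Proof.
apply/homology_classP; rewrite -linearB; apply/boundariesP.
have /homology_classP/boundariesP[u fu] :
  homology_class f (repr (homology_class f z)) = homology_class f z.
  exact: reprK.
by exists (a u); have /= <- := baf u; rewrite fu.
Qed.

Fact homology_fun_is_linear : linear homology_fun.
Proof.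
move=> l h h'; have [z <-] := homology_class_surj h.
have [z' <-] := homology_class_surj h'.
by rewrite -linearP !homology_fun_class 2!linearP.
Qed.

HB.instance Definition _ := GRing.isLinear.Build k (homology f g)
  (homology f' g') *:%R homology_fun homology_fun_is_linear.

Definition homology_map : {linear homology f g -> homology f' g'} :=
  homology_fun.

Lemma homology_map_class z :
  homology_map (homology_class f z) = homology_class f' (cycles_map z).
Proof. exact: homology_fun_class. Qed.

End HomologyMap.

Section FreeModule.
Context (k : fieldType) (K : choiceType).

Lemma freeg_scaleU (c a : k) (x : K) : c *: << a *g x >> = << (c * a) *g x >>.
Proof. by apply/eqP/freeg_eqP => y; rewrite coeffZ !coeffU mulrA. Qed.

Lemma freeg_sumZ (D : {freeg K / k}) :
  D = \sum_(x <- dom D) coeff x D *: << x >>.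
Proof.
rewrite -[LHS]freeg_sumE; apply: eq_bigr => x _.
by rewrite freeg_scaleU mulr1.
Qed.

Lemma freeg_linear_ext (M : lmodType k) (f g : {linear {freeg K / k} -> M}) :
  (forall x : K, f << x >> = g << x >>) -> f =1 g.
Proof.
move=> fg D; rewrite (freeg_sumZ D) !linear_sum; apply: eq_bigr => x _.
by rewrite !linearZ /= fg.
Qed.

Context (M : lmodType k) (f : K -> M).

HB.instance Definition _ := GRing.isZmodMorphism.Build {freeg K / k} M
  (fglift f) (lift_is_additive f).

Lemma fgliftZ (c : k) (D : {freeg K / k}) : fglift f (c *: D) = c *: fglift f D.
Proof.
rewrite [in LHS](freeg_sumZ D) [in RHS](freeg_sumZ D).
rewrite scaler_sumr !raddf_sum; apply: eq_bigr => x _.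
by rewrite /= scalerA !freeg_scaleU !liftU !mulr1 scalerA.
Qed.

Fact fglift_is_scalable : scalable (fglift f). Proof. exact: fgliftZ. Qed.

HB.instance Definition _ := GRing.isScalable.Build k {freeg K / k} M *:%R
  (fglift f) fglift_is_scalable.

Lemma fglift1 x : fglift f << x >> = f x.
Proof. by rewrite liftU scale1r. Qed.

End FreeModule.

Section Simplex.
Context (R : realType).

Definition simplex n : set 'rV[R]_n.+1 :=
  [set v | (forall i, 0 <= v 0 i) /\ \sum_i v 0 i = 1].

Section VertexMap.
Context (m n : nat) (h : 'I_m.+1 -> 'I_n.+1).

(* The affine map sending the vertex e_i to e_(h i), in barycentric
   coordinates. *)
Definition vertex_row (v : 'rV[R]_m.+1) : 'rV[R]_n.+1 :=
  \row_j \sum_(i | h i == j) v 0 i.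

Lemma vertex_row_simplex v : simplex v -> simplex (vertex_row v).
Proof.
move=> [v0 v1]; split=> [j|]; first by rewrite mxE sumr_ge0.
under eq_bigr do rewrite mxE.
by rewrite -v1 [RHS](partition_big h xpredT).
Qed.

Definition vertex_map (v : set_type (@simplex m)) : set_type (@simplex n) :=
  exist _ (vertex_row (val v)) (mem_set (vertex_row_simplex (set_valP v))).

Lemma vertex_row_continuous : continuous vertex_row.
Proof.
move=> v A [P P_nbhs PA].
suff : \forall w \near v, forall i j, P i j (vertex_row w i j).
  by apply: filterS => w Pw; exact: PA.
apply: (@filter_forall _ _
  (fun i w => forall j, P i j (vertex_row w i j)) (nbhs v)) => i.
apply: (@filter_forall _ _ (fun j w => P i j (vertex_row w i j)) (nbhs v)) => j.
have : (fun w : 'rV[R]_m.+1 => vertex_row w i j) @ v --> vertex_row v i j.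
  rewrite mxE; under eq_cvg do rewrite mxE.
  apply: (@cvg_big R _ +%R 0 _ _ _ (nbhs v)) => [|l _].
    exact: add_continuous.
  exact: coord_continuous.
exact.
Qed.

Lemma vertex_map_continuous : continuous vertex_map.
Proof.
apply: continuous_comp_initial => v.
apply: (@continuous_comp _ _ _ set_val vertex_row).
  exact: initial_continuous.
exact: vertex_row_continuous.
Qed.

HB.instance Definition _ :=
  isContinuous.Build _ _ vertex_map vertex_map_continuous.

End VertexMap.

Lemma vertex_map_comp l m n (h : 'I_m.+1 -> 'I_n.+1) (h' : 'I_l.+1 -> 'I_m.+1)
  (v : set_type (@simplex l)) :
  vertex_map h (vertex_map h' v) = vertex_map (h \o h') v.
Proof.
apply/val_inj/rowP => j; rewrite !mxE.
under eq_bigr do rewrite mxE.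
rewrite (exchange_big_dep xpredT) //= [RHS]big_mkcond /=.
apply: eq_bigr => i _.
under eq_bigl => x do rewrite andbC eq_sym.
by rewrite big_mkcondr big_pred1_eq.
Qed.

Definition face_map n (i : 'I_n.+2) :
  continuousType (set_type (@simplex n)) (set_type (@simplex n.+1)) :=
  vertex_map (fintype.lift i).

End Simplex.

Section SingularHomology.
Context (R : realType) (k : fieldType).

Section Chains.
Context (Y : topologicalType).

Definition singular_simplex n : choiceType :=
  continuousType (set_type (@simplex R n)) Y.

Definition Csing n : lmodType k := {freeg (singular_simplex n) / k}.

Definition simplex_face n (s : singular_simplex n.+1) (i : 'I_n.+2) :
  singular_simplex n := s \o face_map R i.

Definition dsingS n : {linear Csing n.+1 -> Csing n} :=
  fglift (fun s : singular_simplex n.+1 =>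
    \sum_(i < n.+2) (-1) ^+ i *: << simplex_face s i >> : Csing n).

(* The complex is extended by zero: dsing 0 is the map to 0, although its
   codomain is formally Csing 0. *)
Definition dsing n : {linear Csing n -> Csing n.-1} :=
  if n is n'.+1 then dsingS n' else \0.

Lemma simplex_faceC n (s : singular_simplex n.+2) (i : 'I_n.+3) (j : 'I_n.+2)
  (i' : 'I_n.+2) (j' : 'I_n.+3) :
  (j < i)%N -> i = i'.+1 :> nat -> j = j' :> nat ->
  simplex_face (simplex_face s i) j = simplex_face (simplex_face s j') i'.
Proof.
move=> ji ii' jj'; apply/continuousEP => v /=; rewrite !vertex_map_comp.
congr (s (vertex_map _ v)); apply/funext => l; apply/val_inj.
rewrite /= /bump -jj'; move: ji; rewrite ii' => ji.
case: (leqP j l) => jl; case: (leqP i' l) => il /=; lia.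
Qed.

Lemma dsingS_dsingS n (c : Csing n.+2) :
  dsingS n (dsingS n.+1 c) = 0.
Proof.
have : dsingS n \o dsingS n.+1 =1 \0.
  apply: freeg_linear_ext => s /=.
  rewrite fglift1 linear_sum /=.
  under eq_bigr => i _ do rewrite linearZ /= fglift1 scaler_sumr.
  rewrite pair_bigA /= (bigID (fun p : 'I_n.+3 * 'I_n.+2 => p.2 < p.1)%N) /=.
  rewrite [X in _ + X](reindex_onto
    (fun p : 'I_n.+3 * 'I_n.+2 => (inord p.2, inord p.1.-1) : 'I_n.+3 * 'I_n.+2)
    (fun p => (inord p.2.+1, inord p.1))) /=; last first.
    move=> [i j] /= ij; have ilt := ltn_ord i; have jlt := ltn_ord j.
    have eqj : (inord j.+1 : 'I_n.+3) = j.+1 :> nat by rewrite (@inordK n.+2).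
    have eqi : (inord i : 'I_n.+2) = i :> nat by rewrite (@inordK n.+1) //; lia.
    by rewrite eqi eqj !inord_val.
  rewrite [X in _ + X](eq_bigl (fun p : 'I_n.+3 * 'I_n.+2 => p.2 < p.1)%N).
    rewrite -big_split /= big1 // => -[i j] /= ji.
    have ilt := ltn_ord i; have jlt := ltn_ord j.
    have eqj : (inord j : 'I_n.+3) = j :> nat by rewrite (@inordK n.+2) //; lia.
    have eqi : (inord i.-1 : 'I_n.+2) = i.-1 :> nat.
      by rewrite (@inordK n.+1) //; lia.
    rewrite (@simplex_faceC n s i j (inord i.-1) (inord j)) //; [|lia].
    rewrite !scalerA -!exprD eqj eqi -scalerDl.
    have -> : (i + j = (j + i.-1).+1)%N by lia.
    by rewrite exprS mulN1r addNr scale0r.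
  move=> [i j] /=; rewrite xpair_eqE -!val_eqE /=.
  have ilt := ltn_ord i; have jlt := ltn_ord j.
  rewrite (@inordK n.+2 j) ?(@inordK n.+1 i.-1); [|lia..].
  case: i ilt => -[|i] /= ? ilt; last by rewrite !inordK; lia.
  rewrite inordK //; case: j jlt => [j /= ?] jlt; lia.
by move=> /(_ c).
Qed.

Lemma dsing_dsing n (c : Csing n.+1) :
  dsing n (dsing n.+1 c) = 0.
Proof. by case: n c => [//|n] c; exact: dsingS_dsingS. Qed.

End Chains.

Definition singular_homology n (Y : topologicalType) : lmodType k :=
  homology (dsing Y n.+1) (dsing Y n).

Section Pushforward.
Context (Y Z : topologicalType) (u : continuousType Y Z).

Definition simplex_push n (s : singular_simplex Y n) : singular_simplex Z n :=
  u \o s.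

Definition chain_map n : {linear Csing Y n -> Csing Z n} :=
  fglift (fun s : singular_simplex Y n => << simplex_push s >> : Csing Z n).

Lemma chain_map_boundary n :
  chain_map n.-1 \o dsing Y n =1 dsing Z n \o chain_map n.
Proof.
case: n => [|n] /=; first by move=> c; rewrite /= linear0.
apply: freeg_linear_ext => s /=; rewrite !fglift1 linear_sum.
apply: eq_bigr => i _; rewrite linearZ /= fglift1.
by congr (_ *: << _ >>); exact/continuousEP.
Qed.

Definition singular_homology_map n :
    {linear singular_homology n Y -> singular_homology n Z} :=
  homology_map (@chain_map_boundary n.+1) (@chain_map_boundary n).

Lemma singular_homology_map_class n (z : cycles (dsing Y n)) :
  singular_homology_map n (homology_class (dsing Y n.+1) z) =
  homology_class (dsing Z n.+1) (cycles_map (@chain_map_boundary n) z).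
Proof. exact: homology_map_class. Qed.

End Pushforward.

Lemma chain_map_id n (Y : topologicalType) :
  chain_map (cat_id (Y : TopCat)) n =1 idfun.
Proof.
apply: freeg_linear_ext => s /=; rewrite fglift1.
by congr << _ >>; exact/continuousEP.
Qed.

Lemma chain_map_comp n (Y Z T : TopCat) (v : mor Z T) (u : mor Y Z) :
  chain_map (cat_comp v u) n =1 chain_map v n \o chain_map u n.
Proof.
apply: freeg_linear_ext => s /=; rewrite !fglift1.
by congr << _ >>; exact/continuousEP.
Qed.

Fact singular_homology_map_id n (Y : TopCat) :
  singular_homology_map (cat_id Y) n =
  cat_id (singular_homology n Y : VectCat k).
Proof.
apply: linear_eqP => h; have [z <-] := homology_class_surj h.
rewrite singular_homology_map_class; congr homology_class.
by apply: val_inj; exact: chain_map_id.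
Qed.

Fact singular_homology_map_comp n (Y Z T : TopCat) (v : mor Z T) (u : mor Y Z) :
  singular_homology_map (cat_comp v u) n =
  cat_comp (singular_homology_map v n : @mor (VectCat k) _ _)
        (singular_homology_map u n).
Proof.
apply: linear_eqP => h; have [z <-] := homology_class_surj h.
rewrite singular_homology_map_class -[RHS]/(singular_homology_map v n
  (singular_homology_map u n (homology_class _ z))).
rewrite 2!singular_homology_map_class; congr homology_class.
by apply: val_inj; exact: (chain_map_comp v u (val z)).
Qed.

Definition singular_homology_functor n : functor TopCat (VectCat k) :=
  @Functor TopCat (VectCat k) (singular_homology n)
    (fun Y Z u => singular_homology_map u n)
    (singular_homology_map_id n) (singular_homology_map_comp n).

End SingularHomology.

Section ParameterPoset.
Context (R : realType).

Record delta2 := Delta2 {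
  endpoints : R * R;
  _ : [&& 0 <= endpoints.1, endpoints.1 <= endpoints.2 & endpoints.2 <= 1]
}.

HB.instance Definition _ := [isSub for endpoints].
HB.instance Definition _ := [Choice of delta2 by <:].

Definition lo (p : delta2) := (endpoints p).1.
Definition hi (p : delta2) := (endpoints p).2.

Definition delta2_le (p q : delta2) := (lo q <= lo p) && (hi p <= hi q).

Fact delta2_le_refl : reflexive delta2_le.
Proof. by move=> p; rewrite /delta2_le !lexx. Qed.

Fact delta2_le_anti : antisymmetric delta2_le.
Proof.
move=> [[a b] p] [[c d] q]; rewrite /delta2_le /lo /hi /=.
move=> /andP[/andP[ca bd] /andP[ac db]]; apply/val_inj => /=.
by congr pair; apply/le_anti/andP.
Qed.

Fact delta2_le_trans : transitive delta2_le.
Proof.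
move=> q p r /andP[pq1 pq2] /andP[qr1 qr2].
by rewrite /delta2_le (le_trans qr1 pq1) (le_trans pq2 qr2).
Qed.

Fact delta2_display : Order.disp_t. Proof. exact: Order.Disp tt tt. Qed.

HB.instance Definition _ := Order.Le_isPOrder.Build delta2_display delta2
  delta2_le_refl delta2_le_anti delta2_le_trans.

Definition param_poset : category := poset_category (delta2 *p R)%type.

Definition Omega_fun (e : R) (p : param_poset) : param_poset := (p.1, p.2 + e).

Lemma Omega_fun_homo (e : R) (p q : param_poset) :
  mor p q -> mor (Omega_fun e p) (Omega_fun e q).
Proof.
by rewrite /= !Order.ProdOrder.leEprod /= lerD2r.
Qed.

Definition Omega (e : {nonneg R}) : functor param_poset param_poset.
Proof.
refine (@Functor param_poset param_poset (Omega_fun e%:num)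
  (fun p q => @Omega_fun_homo e%:num p q) _ _);
  move=> *; exact: bool_irrelevance.
Defined.

End ParameterPoset.

Section Interleaving.
Context (R : realType) (C : category).
Implicit Types (e : {nonneg R}) (M N : functor (param_poset R) C).

Lemma le_Omega2 e (p : param_poset R) : mor p (Omega e (Omega e p)).
Proof.
by rewrite /= Order.ProdOrder.leEprod /= lexx -addrA lerDl addr_ge0.
Qed.

(* The composites end at Omega e (Omega e p), which is Omega (2 e) p up to the
   associativity of addition in R; see Omega_Omega. *)
Definition interleaved e M N : Prop :=
  exists (phi : nat_trans M (functor_comp N (Omega e)))
         (psi : nat_trans N (functor_comp M (Omega e))),
    forall p : param_poset R,
      cat_comp (psi (Omega e p)) (phi p) = functor_map M (le_Omega2 e p) /\
      cat_comp (phi (Omega e p)) (psi p) = functor_map N (le_Omega2 e p).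

Definition interleaving_dist M N : \bar R :=
  ereal_inf [set e%:num%:E | e in [set e : {nonneg R} | interleaved e M N]].

End Interleaving.

Lemma Omega_Omega (R : realType) (e : {nonneg R}) (p : param_poset R) :
  Omega e (Omega e p) = Omega (2 * e%:num)%:nng p.
Proof. by congr pair; rewrite /= -addrA mulr2n mulrDl mul1r. Qed.

Definition unit_interval (R : realType) : topologicalType :=
  set_type (`[0, 1]%classic : set R).

Section SublevelDiagram.
Context (R : realType) (X : topologicalType) (ft : unit_interval R * X -> R).

Definition graph_map (tx : unit_interval R * X) : unit_interval R * R :=
  (tx.1, ft tx).

Definition sublevel (p : param_poset R) : set (unit_interval R * X) :=
  graph_map @^-1` ([set t | lo p.1 <= val t <= hi p.1] `*` `]-oo, p.2]).

Lemma sublevel_homo (p q : param_poset R) :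
  mor p q -> sublevel p `<=` sublevel q.
Proof.
rewrite /= Order.ProdOrder.leEprod => /andP[/andP[lo_qp hi_pq] c_pq] [t x].
rewrite /sublevel /= !in_itv /= => -[/andP[lo_t t_hi] ft_c].
split; last exact: le_trans ft_c c_pq.
by rewrite (le_trans lo_qp lo_t) (le_trans t_hi hi_pq).
Qed.

End SublevelDiagram.

Section Inclusion.
Context (Y : topologicalType) (A B : set Y) (AB : A `<=` B).

Definition subspace_incl (y : set_type A) : set_type B :=
  exist _ (val y) (mem_set (AB (set_valP y))).

Lemma subspace_incl_continuous : continuous subspace_incl.
Proof. by apply: continuous_comp_initial; exact: initial_continuous. Qed.

HB.instance Definition _ :=
  isContinuous.Build _ _ subspace_incl subspace_incl_continuous.

End Inclusion.

Section Persistence.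
Context (R : realType) (X : topologicalType) (ft : unit_interval R * X -> R).

Let sublevel_map (p q : param_poset R) (pq : mor p q) :
  continuousType (set_type (sublevel ft p)) (set_type (sublevel ft q)) :=
  subspace_incl (sublevel_homo pq).

Definition sublevel_diagram : functor (param_poset R) TopCat.
Proof.
refine (@Functor (param_poset R) TopCat (fun p => set_type (sublevel ft p))
  sublevel_map _ _); move=> *; apply/continuousEP => y; exact: val_inj.
Defined.

Definition persistence_module (k : fieldType) (j : nat) :
  functor (param_poset R) (VectCat k) :=
  functor_comp (singular_homology_functor R k j) sublevel_diagram.

End Persistence.

(* The supremum is taken in [0, +oo]: it is 0, not -oo, when X is empty. *)
Definition sup_dist (R : realType) (X : topologicalType)
    (ft gt : unit_interval R * X -> R) : \bar R :=
  ereal_sup (0%E |` range (fun tx => `|ft tx - gt tx|%:E)).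

(* Main.v *)
Require Import Defs.
From HB Require Import structures.
From mathcomp Require Import all_boot all_order all_algebra.
From mathcomp Require Import all_classical all_reals topology ereal.

(** If [|ft - gt| <= e], then [ft^-1(-oo, c]] is contained in
    [gt^-1(-oo, c + e]] and vice versa, over every [[a, b]]. These inclusions
    interleave the diagrams of spaces, and any functor, in particular [H_j],
    carries an interleaving to an interleaving. A finite supremum is itself an
    admissible [e], so no limiting argument is needed. *)

Import Order.TTheory GRing.Theory Num.Theory.

Local Open Scope ring_scope.
Local Open Scope ereal_scope.

(** Whiskering: [K] is applied to each component of [phi] and [psi]. Since [K] preserves
    composition, both triangle identities persist. *)
Lemma interleaved_functor_comp (R : realType) (C D : category)
    (K : functor C D) (e : {nonneg R}) (M N : functor (param_poset R) C) :
  interleaved e M N -> interleaved e (functor_comp K M) (functor_comp K N).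
Proof.
move=> [phi [psi phi_psi]].
(* Stated for generic [M'], [N'] so as to serve both [phi] and [psi]; the two bracketings of the
   composite of [K], [N'] and [Omega e] agree by conversion. *)
have whisker (M' N' : functor (param_poset R) C)
    (eta : nat_trans M' (functor_comp N' (Omega e))) (p q : param_poset R)
    (u : mor p q) :
  cat_comp (functor_map K (eta q)) (functor_map (functor_comp K M') u) =
  cat_comp (functor_map (functor_comp (functor_comp K N') (Omega e)) u)
    (functor_map K (eta p)).
  transitivity (functor_map K (cat_comp (eta q) (functor_map M' u))).
    exact: esym (functor_map_comp K (eta q) (functor_map M' u)).
  by rewrite naturality; exact: (functor_map_comp K _ (eta p)).
exists (@NatTrans _ _ (functor_comp K M)
  (functor_comp (functor_comp K N) (Omega e))
  (fun p => functor_map K (phi p)) (whisker _ _ phi)).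
exists (@NatTrans _ _ (functor_comp K N)
  (functor_comp (functor_comp K M) (Omega e))
  (fun p => functor_map K (psi p)) (whisker _ _ psi)).
move=> p; have [psi_phi phi_psi'] := phi_psi p.
split; rewrite /=.
  by rewrite -[LHS](functor_map_comp K) psi_phi.
by rewrite -[LHS](functor_map_comp K) phi_psi'.
Qed.

Lemma sublevel_shift (R : realType) (X : topologicalType)
    (ft gt : unit_interval R * X -> R) (e : {nonneg R}) :
  (forall tx, `|ft tx - gt tx| <= e%:num)%R ->
  forall p, (sublevel ft p `<=` sublevel gt (Omega e p))%classic.
Proof.
move=> fg p tx [/= ab fc]; split=> //=; move: fc; rewrite !in_itv /= => fc.
(* With [c = p.2], this gives [gt tx <= ft tx + e <= c + e]; the condition on the interval is
   untouched, as [Omega e] moves only the last coordinate. *)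
have := fg tx; rewrite ler_distlC => /andP[_ gf].
by rewrite (le_trans gf)// lerD2r.
Qed.

Lemma interleaved_sublevel_diagram (R : realType) (X : topologicalType)
    (ft gt : unit_interval R * X -> R) (e : {nonneg R}) :
  (forall tx, `|ft tx - gt tx| <= e%:num)%R ->
  interleaved e (sublevel_diagram ft) (sublevel_diagram gt).
Proof.
move=> fg.
have gf tx : (`|gt tx - ft tx| <= e%:num)%R by rewrite distrC.
have incl_natural (u v : unit_interval R * X -> R)
    (uv : forall p, (sublevel u p `<=` sublevel v (Omega e p))%classic)
    (p q : param_poset R) (pq : mor p q) :
  cat_comp (subspace_incl (uv q) : @mor TopCat _ _)
    (functor_map (sublevel_diagram u) pq) =
  cat_comp (functor_map (functor_comp (sublevel_diagram v) (Omega e)) pq)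
    (subspace_incl (uv p)).
  (* All four maps are inclusions, so both composites keep the underlying point of [y]. *)
  by apply/continuousEP => y; exact: val_inj.
exists (@NatTrans _ _ (sublevel_diagram ft)
  (functor_comp (sublevel_diagram gt) (Omega e))
  (fun p => subspace_incl (sublevel_shift _ _ _ _ _ fg p))
  (incl_natural _ _ (sublevel_shift _ _ _ _ _ fg))).
exists (@NatTrans _ _ (sublevel_diagram gt)
  (functor_comp (sublevel_diagram ft) (Omega e))
  (fun p => subspace_incl (sublevel_shift _ _ _ _ _ gf p))
  (incl_natural _ _ (sublevel_shift _ _ _ _ _ gf))).
by move=> p; split; apply/continuousEP => y; exact: val_inj.
Qed.

Lemma le_sup_dist (R : realType) (X : topologicalType)
    (ft gt : unit_interval R * X -> R) tx :
  `|ft tx - gt tx|%:E <= sup_dist ft gt.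
Proof. by apply: ereal_sup_ubound; right; exists tx. Qed.

Lemma sup_dist_ge0 (R : realType) (X : topologicalType)
    (ft gt : unit_interval R * X -> R) : 0 <= sup_dist ft gt.
Proof. by apply: ereal_sup_ubound; left. Qed.

Theorem theorem3p2 (R : realType) (X : topologicalType)
    (ft gt : unit_interval R * X -> R) (k : fieldType) (j : nat) :
  interleaving_dist (persistence_module ft k j) (persistence_module gt k j)
    <= sup_dist ft gt.
Proof.
move: (sup_dist_ge0 R X ft gt) (le_sup_dist R X ft gt).
(* The value [+oo] makes the bound trivial, and [-oo] contradicts nonnegativity. A real value [r]
   will be the interleaving parameter. *)
case: (sup_dist ft gt) => [r|_ _|//]; last exact: leey.
rewrite lee_fin => r0 fg.
apply: ereal_inf_lbound; exists (NngNum r0) => //=.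
apply: interleaved_functor_comp; apply: interleaved_sublevel_diagram => tx.
by rewrite -lee_fin; exact: fg.
Qed.
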